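(* Let $F\in\mathcal{O}_K[x,z]$ be a non-singular binary quartic form. Suppose that $v(F)\in\{0,1\}$ but $F$ has positive level; if $\mathrm{char}(k)=2$, suppose further that $F$ is non-minimal. Then: (i) the reduction modulo $\pi$ of $F_1(x,z)=\pi^{-v(F)}F(x,z)$ has a triple or quadruple root defined over $k$; (ii) the following procedure replaces $F$ by a $K$-equivalent integral binary quartic of the same level: apply a substitution $(x,z)\leftarrow(m_{11}x+m_{21}z,\ m_{12}x+m_{22}z)$ with $(m_{ij})\in GL_2(\mathcal{O}_K)$ moving the repeated root of $F_1$ mod $\pi$ to $(x:z)=(0:1)$, and then replace $F(x,z)$ by $\pi^{-2}F(\pi x,z)$; (iii) if $F$ is non-minimal, then at most $2$ iterations of the procedure in (ii) produce a binary quartic $F$ with $v(F)\geq2$.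
   Context: $K$ is a field with normalised discrete valuation $v:K^\times\to\mathbb{Z}$, valuation ring $\mathcal{O}_K$, uniformiser $\pi$, and perfect residue field $k=\mathcal{O}_K/\pi\mathcal{O}_K$. For a binary form $F$, $v(F)$ is the minimum of the valuations of its coefficients. A binary quartic $F=ax^4+bx^3z+cx^2z^2+dxz^3+ez^4$ over $K$ is regarded as the genus one model $y^2=F(x,z)$. Binary quartics $F,F'$ are $K$-equivalent if $F'(x,z)=\mu^2F(m_{11}x+m_{21}z,m_{12}x+m_{22}z)$ for some $\mu\in K^\times$ and $(m_{ij})\in GL_2(K)$. Invariants: $I=12ae-3bd+c^2$, $J=72ace-27ad^2-27b^2e+9bcd-2c^3$, $c_4=2^4I$, $c_6=2^5J$, $\Delta(F)=(c_4^3-c_6^2)/1728$; $F$ is non-singular if $\Delta(F)\ne0$. Then $y^2=F$ defines a smooth genus one curve whose Jacobian $E$ has minimal discriminant $\Delta_E$ over $K$, and $v(\Delta(F))=v(\Delta_E)+12\ell$ for an integer $\ell$, the level of $F$. $F$ is integral if $F\in\mathcal{O}_K[x,z]$; an integral $F$ is minimal if $v(\Delta(F))$ is minimal among all integral binary quartics $K$-equivalent to $F$, and non-minimal otherwise. *)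

(* Defs.v *)
From HB Require Import structures.
From mathcomp Require Import all_boot all_order all_algebra.
From mathcomp Require Import ring.
Set Implicit Arguments. Unset Strict Implicit. Unset Printing Implicit Defensive.
Import Order.TTheory GRing.Theory Num.Theory.
Local Open Scope ring_scope.

(* A field K with a normalised discrete valuation v : K^x -> Z,        *)
(* uniformiser pi, and residue field k (perfect), given through the    *)
(* reduction map red : O_K -> k (extended arbitrarily outside O_K).    *)
(* The value of [dv_v] at 0 is irrelevant (junk).                      *)
Record dvf (K k : fieldType) := DVF {
  dv_v : K -> int;
  dv_pi : K;
  dv_red : K -> k;
  dv_vM : forall x y, x != 0 -> y != 0 -> dv_v (x * y) = dv_v x + dv_v y;
  dv_vD : forall x y, x != 0 -> y != 0 -> x + y != 0 ->
            Num.min (dv_v x) (dv_v y) <= dv_v (x + y);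
  dv_pi_neq0 : dv_pi != 0;
  dv_v_pi : dv_v dv_pi = 1;
  dv_redD : forall x y, (x == 0) || (0 <= dv_v x) -> (y == 0) || (0 <= dv_v y) ->
              dv_red (x + y) = dv_red x + dv_red y;
  dv_redM : forall x y, (x == 0) || (0 <= dv_v x) -> (y == 0) || (0 <= dv_v y) ->
              dv_red (x * y) = dv_red x * dv_red y;
  dv_red1 : dv_red 1 = 1;
  dv_red_ker : forall x, (x == 0) || (0 <= dv_v x) ->
              (dv_red x == 0) = ((x == 0) || (0 < dv_v x));
  dv_red_surj : forall y : k, exists2 x, (x == 0) || (0 <= dv_v x) & dv_red x = y;
  dv_perfect : forall p, p \in [pchar k] -> forall y : k, exists z : k, z ^+ p = y
}.

Section Defs.
Variables (K k : fieldType) (D : dvf K k).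
Local Notation v := (dv_v D).
Local Notation pi := (dv_pi D).
Local Notation red := (dv_red D).

Definition intK (x : K) : bool := (x == 0) || (0 <= v x).

Record quartic (R : Type) := Quartic { qa : R; qb : R; qc : R; qd : R; qe : R }.

Definition qcoefs (R : Type) (F : quartic R) : seq R :=
  [:: qa F; qb F; qc F; qd F; qe F].

Definition qeval (R : pzRingType) (F : quartic R) (x z : R) : R :=
  qa F * x ^+ 4 + qb F * x ^+ 3 * z + qc F * x ^+ 2 * z ^+ 2
  + qd F * x * z ^+ 3 + qe F * z ^+ 4.

Definition qscale (R : pzRingType) (l : R) (F : quartic R) : quartic R :=
  Quartic (l * qa F) (l * qb F) (l * qc F) (l * qd F) (l * qe F).

Definition qcoef (R : Type) (F : quartic R) (i : nat) (d0 : R) : R :=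
  match i with 4 => qa F | 3 => qb F | 2 => qc F | 1 => qd F | 0 => qe F | _ => d0 end.

Definition qI (R : pzRingType) (F : quartic R) : R :=
  12 * qa F * qe F - 3 * qb F * qd F + qc F ^+ 2.
Definition qJ (R : pzRingType) (F : quartic R) : R :=
  72 * qa F * qc F * qe F - 27 * qa F * qd F ^+ 2 - 27 * qb F ^+ 2 * qe F
  + 9 * qb F * qc F * qd F - 2 * qc F ^+ 3.
Definition qc4 (R : pzRingType) (F : quartic R) : R := 16 * qI F.
Definition qc6 (R : pzRingType) (F : quartic R) : R := 32 * qJ F.

(* y^2 + a1 xy + a3 y = x^3 + a2 x^2 + a4 x + a6 *)
Record wmodel (R : Type) := WM { wa1 : R; wa2 : R; wa3 : R; wa4 : R; wa6 : R }.

Definition wdisc (R : pzRingType) (W : wmodel R) : R :=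
  let b2 := wa1 W ^+ 2 + 4 * wa2 W in
  let b4 := 2 * wa4 W + wa1 W * wa3 W in
  let b6 := wa3 W ^+ 2 + 4 * wa6 W in
  let b8 := wa1 W ^+ 2 * wa6 W + 4 * wa2 W * wa6 W - wa1 W * wa3 W * wa4 W
            + wa2 W * wa3 W ^+ 2 - wa4 W ^+ 2 in
  - b2 ^+ 2 * b8 - 8 * b4 ^+ 3 - 27 * b6 ^+ 2 + 9 * b2 * b4 * b6.

(* change of coordinates x = u^2 x' + r, y = u^3 y' + s u^2 x' + t *)
Definition wtrans (W : wmodel K) (u r s t : K) : wmodel K :=
  WM ((wa1 W + 2 * s) / u)
     ((wa2 W - s * wa1 W + 3 * r - s ^+ 2) / u ^+ 2)
     ((wa3 W + r * wa1 W + 2 * t) / u ^+ 3)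
     ((wa4 W - s * wa3 W + 2 * r * wa2 W - (t + r * s) * wa1 W + 3 * r ^+ 2
        - 2 * s * t) / u ^+ 4)
     ((wa6 W + r * wa4 W + r ^+ 2 * wa2 W + r ^+ 3 - t * wa3 W - t ^+ 2
        - r * t * wa1 W) / u ^+ 6).

Definition wiso (W W' : wmodel K) : Prop :=
  exists u r s t, u != 0 /\ W' = wtrans W u r s t.

Definition wintegral (W : wmodel K) : bool :=
  [&& intK (wa1 W), intK (wa2 W), intK (wa3 W), intK (wa4 W) & intK (wa6 W)].

(* Classical Weierstrass equation of the Jacobian of y^2 = F(x,z):    *)
(* y^2 = x^3 + c x^2 + (bd - 4ae) x + (ad^2 + b^2 e - 4ace).          *)
Definition jacW (R : pzRingType) (F : quartic R) : wmodel R :=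
  WM 0 (qc F) 0 (qb F * qd F - 4 * qa F * qe F)
     (qa F * qd F ^+ 2 + qb F ^+ 2 * qe F - 4 * qa F * qc F * qe F).

(* Delta(F): the universal integral polynomial with 1728 Delta = c4^3 - c6^2 *)
Definition discF (R : pzRingType) (F : quartic R) : R := wdisc (jacW F).

Definition nonsingular (F : quartic K) : bool := discF F != 0.

Definition qintegral (F : quartic K) : bool := all intK (qcoefs F).

Definition vform (F : quartic K) : int :=
  let l := [seq v c | c <- qcoefs F & c != 0] in foldr Num.min (head 0 l) l.

Definition Kequiv (F F' : quartic K) : Prop :=
  exists (mu : K) (M : 'M[K]_2), mu != 0 /\ \det M != 0 /\
    forall x z, qeval F' x z =
      mu ^+ 2 * qeval F (M 0 0 * x + M 1 0 * z) (M 0 1 * x + M 1 1 * z).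

Definition is_level (F : quartic K) (l : int) : Prop :=
  exists W, wintegral W /\ wiso (jacW F) W /\
    (forall W', wintegral W' -> wiso (jacW F) W' -> v (wdisc W) <= v (wdisc W')) /\
    v (discF F) = v (wdisc W) + 12%:Z * l.

Definition nonminimal (F : quartic K) : Prop :=
  exists F', qintegral F' /\ Kequiv F F' /\ v (discF F') < v (discF F).

(* reduction mod pi of an integral quartic, as a polynomial in X where *)
(* the binary form monomial x^i z^(4-i) corresponds to X^i             *)
Definition qred (F : quartic K) : {poly k} :=
  \poly_(i < 5) red (qcoef F i 0).

(* the reduction of H has (x0 : z0) in P^1(k) as a root of multiplicity
   at least 3, i.e. (z0 x - x0 z)^3 divides it *)
Definition triple_root_at (H : quartic K) (x0 z0 : k) : Prop :=
  exists p q : k, ((p != 0) || (q != 0)) /\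
    qred H = ('X * z0%:P - x0%:P) ^+ 3 * ('X * p%:P + q%:P).

Definition has_triple_root (H : quartic K) : Prop :=
  exists x0 z0 : k, ((x0 != 0) || (z0 != 0)) /\ triple_root_at H x0 z0.

Definition GL2O (M : 'M[K]_2) : Prop :=
  [/\ intK (M 0 0), intK (M 0 1), intK (M 1 0), intK (M 1 1)
      & v (\det M) = 0 /\ \det M != 0].

Definition step (F : quartic K) (M : 'M[K]_2) (G F' : quartic K) : Prop :=
  [/\ GL2O M,
      (forall x z, qeval G x z = qeval F (M 0 0 * x + M 1 0 * z) (M 0 1 * x + M 1 1 * z)),
      triple_root_at (qscale (pi ^ (- vform F)) G) 0 1 &
      (forall x z, qeval F' x z = pi ^- 2 * qeval G (pi * x) z)].

End Defs.

Lemma discF_spec (R : comRingType) (F : quartic R) :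
  1728 * discF F = qc4 F ^+ 3 - qc6 F ^+ 2.
Proof. rewrite /discF /wdisc /jacW /qc4 /qc6 /qI /qJ /=; ring. Qed.

(* Main.v *)
(** The idea is to put a non-minimal [F] in the shape given by the Smith normal form of
    the substitution that decreases its discriminant.  After a change of variables over
    O_K, the coefficients of x^4, x^3 z, ..., z^4 have valuations at least (0,1,2,3,4) or
    (0,0,2,4,6), so (0 : 1) is a triple root of [F_1], and [pi^-2 F(pi x, z)] has
    valuations at least (2,2,2,2,2), respectively (2,1,2,3,4), the next step turning the
    latter into (4,2,2,2,2).  A triple root is unique, hence two choices of the
    substitution in (ii) differ by one fixing (0 : 1) modulo pi, and the results of the
    procedure are O_K-equivalent.

    If [F] is only of positive level, then char k <> 2, and a minimal Weierstrass equation
    of the Jacobian yields [r] such that the resolvent cubic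
    f(X) = X^3 + c X^2 + (bd - 4ae) X + (ad^2 + b^2 e - 4ace) satisfies
    v(f(r)) >= 6, v(f'(r)) >= 4 and v(f''(r)/2) >= 2.  A quartic over [k] whose resolvent
    cubic is a perfect cube has a triple root, and the same congruences give v(e) >= 2
    once the triple root is moved to (0 : 1). *)

Require Import Defs.
From HB Require Import structures.
From mathcomp Require Import all_boot all_order all_algebra.
From mathcomp Require Import ring zify.
Import Order.TTheory GRing.Theory Num.Theory.
Local Open Scope ring_scope.
Set Implicit Arguments. Unset Strict Implicit. Unset Printing Implicit Defensive.

(** * Valuation bounds and the reduction map *)

Ltac vlia :=
  repeat match goal with H : context [dv_v _ _] |- _ => revert H end;
  repeat match goal with
  | |- context [dv_v ?D ?x] => let y := fresh "y" in set y := (dv_v D x); clearbody y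
  end; lia.

Section Valuation.
Variables (K k : fieldType) (D : dvf K k).
Local Notation v := (dv_v D).
Local Notation pi := (dv_pi D).
Local Notation red := (dv_red D).

(** Zero counts as having infinite valuation, whatever [dv_v] returns there; for [n = 0] this is
    [intK]. *)
Definition vge (n : int) (x : K) : bool := (x == 0) || (n <= v x).

Lemma v1 : v 1 = 0.
Proof. by have := dv_vM D (oner_neq0 K) (oner_neq0 K); rewrite mulr1; vlia. Qed.

Lemma vX x m : x != 0 -> v (x ^+ m) = v x * m%:Z.
Proof.
move=> x0; elim: m => [|m IH]; first by rewrite expr0 v1 mulr0.
by rewrite exprS dv_vM // ?expf_neq0 // IH; vlia.
Qed.

Lemma vN1 : v (-1) = 0.
Proof.
have n0 : (-1 : K) != 0 by rewrite oppr_eq0 oner_eq0.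
by have := vX 2 n0; rewrite sqrrN expr1n v1; vlia.
Qed.

Lemma vV x : x != 0 -> v x^-1 = - v x.
Proof.
move=> x0; have xV0 : x^-1 != 0 by rewrite invr_eq0.
by have := dv_vM D x0 xV0; rewrite divff // v1; vlia.
Qed.

Lemma vpiz (n : int) : v (pi ^ n) = n.
Proof.
have p0 := dv_pi_neq0 D.
case: n => n; first by rewrite -exprnP vX // dv_v_pi; vlia.
by rewrite NegzE -exprnN vV ?expf_neq0 // vX // dv_v_pi; vlia.
Qed.

Lemma vge0 n : vge n 0. Proof. by rewrite /vge eqxx. Qed.

Lemma vgeE n x : x != 0 -> vge n x = (n <= v x).
Proof. by rewrite /vge => /negPf ->. Qed.

Lemma vgeM_l n x y : y != 0 -> vge n (y * x) = vge (n - v y) x.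
Proof.
move=> y0; rewrite /vge mulf_eq0 (negPf y0) /=.
by case: eqVneq => //= x0; rewrite dv_vM //; vlia.
Qed.

Lemma vgeM_r n x y : y != 0 -> vge n (x * y) = vge (n - v y) x.
Proof. by move=> y0; rewrite mulrC vgeM_l. Qed.

Lemma vgeW m n x : vge n x -> m <= n -> vge m x.
Proof. by rewrite /vge; case: eqP => //= _; vlia. Qed.

Lemma vgeD n x y : vge n x -> vge n y -> vge n (x + y).
Proof.
case: (eqVneq x 0) => [->|x0]; first by rewrite add0r.
case: (eqVneq y 0) => [->|y0]; first by rewrite addr0.
case: (eqVneq (x + y) 0) => [->|xy0]; first by rewrite vge0.
rewrite !vgeE // => nx ny; apply: le_trans (dv_vD D x0 y0 xy0).
by rewrite le_min nx ny.
Qed.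

Lemma vgeN n x : vge n (- x) = vge n x.
Proof. by rewrite -mulN1r vgeM_l ?oppr_eq0 ?oner_eq0 // vN1 subr0. Qed.

Lemma vgeM m n x y : vge m x -> vge n y -> vge (m + n) (x * y).
Proof.
case: (eqVneq x 0) => [->|x0]; first by rewrite mul0r !vge0.
by rewrite vgeM_l // (vgeE _ x0) => mx ny; apply: (vgeW ny); vlia.
Qed.

Lemma vge_1 : vge 0 1. Proof. by rewrite vgeE ?oner_eq0 // v1. Qed.

Lemma vge_nat m : vge 0 m%:R.
Proof. by elim: m => [|m IH]; rewrite ?vge0 // mulrS vgeD ?vge_1. Qed.

Lemma vgeX m x : vge 0 x -> vge 0 (x ^+ m).
Proof.
move=> x0; elim: m => [|m IH]; first exact: vge_1.
by rewrite exprS; apply: (@vgeM 0 0).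
Qed.

Lemma vgeZl n x y : vge 0 x -> vge n y -> vge n (x * y).
Proof. by move=> hx /(vgeM hx); rewrite add0r. Qed.

Lemma vgeZr n x y : vge n x -> vge 0 y -> vge n (x * y).
Proof. by move=> hx /(vgeM hx); rewrite addr0. Qed.

Lemma vgeXl n m x : vge n x -> vge 0 x -> vge n (x ^+ m.+1).
Proof. by move=> h h0; rewrite exprS vgeZr ?vgeX. Qed.

Lemma vgePn x : vge 0 x -> ~~ vge 1 x -> x != 0 /\ v x = 0.
Proof. by rewrite /vge negb_or => h /andP[h1]; rewrite (negPf h1) /= in h *; vlia. Qed.

Lemma red0 : red 0 = 0.
Proof. by apply/eqP; rewrite dv_red_ker eqxx. Qed.

Lemma redN x : vge 0 x -> red (- x) = - red x.
Proof.
move=> x0; apply/eqP; rewrite -addr_eq0 -dv_redD; last 2 first.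
- by rewrite [X in is_true X]vgeN.
- exact: x0.
by rewrite addNr red0.
Qed.

Lemma redD x y : vge 0 x -> vge 0 y -> red (x + y) = red x + red y.
Proof. exact: dv_redD. Qed.

Lemma redM x y : vge 0 x -> vge 0 y -> red (x * y) = red x * red y.
Proof. exact: dv_redM. Qed.

Lemma redX x m : vge 0 x -> red (x ^+ m) = red x ^+ m.
Proof.
move=> x0; elim: m => [|m IH]; first by rewrite !expr0 dv_red1.
by rewrite !exprS redM ?vgeX // IH.
Qed.

Lemma red_nat m : red m%:R = m%:R.
Proof.
by elim: m => [|m IH]; rewrite ?red0 // !mulrS redD ?vge_1 ?vge_nat // IH dv_red1.
Qed.

Lemma red_eq0 x : vge 0 x -> (red x == 0) = vge 1 x.
Proof. by move=> x0; rewrite dv_red_ker // /vge; case: eqP => //= _; vlia. Qed.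

End Valuation.

(** * Linear substitutions in binary quartics *)

Section Substitution.
Variable R : comPzRingType.
Implicit Types (F : quartic R) (M N : 'M[R]_2).

(** [M] acts on the row vector [(x, z)] from the right, hence the reversed product in
    [qsubst_mul]. *)
Definition qsubst F M : quartic R :=
  let p := M 0 0 in let q := M 0 1 in let r := M 1 0 in let t := M 1 1 in
  let: Quartic a b c d e := F in
  Quartic (qeval F p q)
    (4 * a * p ^+ 3 * r + b * (p ^+ 3 * t + 3 * p ^+ 2 * r * q)
     + c * (2 * p ^+ 2 * q * t + 2 * p * r * q ^+ 2)
     + d * (3 * p * q ^+ 2 * t + r * q ^+ 3) + 4 * e * q ^+ 3 * t)
    (6 * a * p ^+ 2 * r ^+ 2 + b * (3 * p * r ^+ 2 * q + 3 * p ^+ 2 * r * t)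
     + c * (p ^+ 2 * t ^+ 2 + 4 * p * r * q * t + r ^+ 2 * q ^+ 2)
     + d * (3 * p * q * t ^+ 2 + 3 * r * q ^+ 2 * t) + 6 * e * q ^+ 2 * t ^+ 2)
    (4 * a * p * r ^+ 3 + b * (r ^+ 3 * q + 3 * p * r ^+ 2 * t)
     + c * (2 * p * r * t ^+ 2 + 2 * r ^+ 2 * q * t)
     + d * (p * t ^+ 3 + 3 * r * q * t ^+ 2) + 4 * e * q * t ^+ 3)
    (qeval F r t).

Lemma qeval_subst F M x z :
  qeval (qsubst F M) x z =
  qeval F (M 0 0 * x + M 1 0 * z) (M 0 1 * x + M 1 1 * z).
Proof. by case: F => a b c d e; rewrite /qsubst /qeval /=; ring. Qed.

Lemma mul_mx22 M N i j : (M *m N) i j = M i 0 * N 0 j + M i 1 * N 1 j.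
Proof.
rewrite mxE !big_ord_recl big_ord0 addr0.
by congr (M _ _ * N _ _ + M _ _ * N _ _); apply/val_inj.
Qed.

Lemma det_mx22 M : \det M = M 0 0 * M 1 1 - M 0 1 * M 1 0.
Proof.
rewrite (expand_det_row _ 0) !big_ord_recl big_ord0 addr0 /cofactor !det_mx11 !mxE /=.
rewrite /bump /= !addn0 expr0 expr1 mul1r mulN1r mulrN.
by congr (_ * M _ _ - M _ _ * M _ _); apply/val_inj.
Qed.

Lemma qsubst_mul F M N : qsubst (qsubst F M) N = qsubst F (N *m M).
Proof.
by case: F => a b c d e; rewrite /qsubst /qeval /= !mul_mx22; congr Quartic; ring.
Qed.

Lemma qsubst1 F : qsubst F 1%:M = F.
Proof. by case: F => a b c d e; rewrite /qsubst /qeval /= !mxE /=; congr Quartic; ring. Qed.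

Lemma qsubst_scale l F M : qsubst (qscale l F) M = qscale l (qsubst F M).
Proof. by case: F => a b c d e; rewrite /qsubst /qscale /qeval /=; congr Quartic; ring. Qed.

Lemma qeval_scale l F x z : qeval (qscale l F) x z = l * qeval F x z.
Proof. by case: F => a b c d e; rewrite /qsubst /qeval /=; ring. Qed.

Definition mx22 (p q r t : R) : 'M[R]_2 :=
  \matrix_(i, j) if i == 0 then (if j == 0 then p else q) else (if j == 0 then r else t).

Lemma mx22E p q r t : (mx22 p q r t 0 0 = p) * (mx22 p q r t 0 1 = q) *
  (mx22 p q r t 1 0 = r) * (mx22 p q r t 1 1 = t).
Proof. by rewrite !mxE. Qed.

Lemma mx22P M N : M 0 0 = N 0 0 -> M 0 1 = N 0 1 -> M 1 0 = N 1 0 -> M 1 1 = N 1 1 -> M = N.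
Proof.
move=> h1 h2 h3 h4; have ord2 (i : 'I_2) : i = 0 \/ i = 1.
  by case: i => -[|[|//]] h; [left | right]; apply/val_inj.
by apply/matrixP => i j; case: (ord2 i) => ->; case: (ord2 j) => ->.
Qed.

End Substitution.

(** * Weierstrass models and the discriminant under substitution *)

Section Invariants.
Variable K : fieldType.
Implicit Types (F : quartic K) (W : wmodel K) (M : 'M[K]_2).

Lemma wdisc_trans W u r s t : u != 0 ->
  wdisc (wtrans W u r s t) = wdisc W / u ^+ 12.
Proof. by case: W => a1 a2 a3 a4 a6 u0; rewrite /wdisc /=; field. Qed.

Lemma wiso_sym W W' : wiso W W' -> wiso W' W.
Proof.
case: W => a1 a2 a3 a4 a6 [u [r [s [t [u0 ->]]]]].
exists u^-1, (- r / u ^+ 2), (- s / u), ((r * s - t) / u ^+ 3).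
split; first by rewrite invr_eq0.
by rewrite /wtrans /=; congr WM; field; rewrite ?oner_eq0 ?u0.
Qed.

Lemma wiso_trans W1 W2 W3 : wiso W1 W2 -> wiso W2 W3 -> wiso W1 W3.
Proof.
case: W1 => a1 a2 a3 a4 a6 [u [r [s [t [u0 ->]]]]] [u' [r' [s' [t' [u'0 ->]]]]].
exists (u * u'), (u ^+ 2 * r' + r), (u * s' + s), (u ^+ 3 * t' + u ^+ 2 * s * r' + t).
split; first by rewrite mulf_neq0.
by rewrite /wtrans /=; congr WM; field; rewrite ?oner_eq0 ?u0 ?u'0.
Qed.

(* [r] is read off from [6 x1^2 x2^2 = 3 * 2 x1^2 x2^2] in the coefficient of [x^2 z^2]. *)
Lemma jacW_subst F M l : l != 0 -> \det M != 0 ->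
  exists r, jacW (qscale (l ^+ 2) (qsubst F M)) =
    wtrans (jacW F) (l * \det M)^-1 r 0 0.
Proof.
move=> l0; rewrite det_mx22; case: F => a b c d e D0.
pose p := M 0 0; pose q := M 0 1; pose r := M 1 0; pose t := M 1 1.
exists ((2 * a * p ^+ 2 * r ^+ 2 + b * p * r * (p * t + q * r)
  + 2 * c * p * q * r * t + d * q * t * (p * t + q * r) + 2 * e * q ^+ 2 * t ^+ 2)
  / (p * t - q * r) ^+ 2).
rewrite /jacW /wtrans /qsubst /qeval /= -/p -/q -/r -/t in D0 *.
by congr WM; field; rewrite ?l0 ?D0 ?oner_eq0.
Qed.

Lemma discF_subst F M l : l != 0 -> \det M != 0 ->
  discF (qscale (l ^+ 2) (qsubst F M)) = (l * \det M) ^+ 12 * discF F.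
Proof.
move=> l0 D0; have [r rE] := jacW_subst F l0 D0.
by rewrite /discF rE wdisc_trans ?invr_eq0 ?mulf_neq0 // exprVn invrK mulrC.
Qed.

End Invariants.

(** In a product, one factor must carry the whole bound and the other only be integral; bounds that
    add up are supplied separately through [vgeM]. *)
Ltac vg := solve [ assumption | lazymatch goal with
  | |- context [intK ?D ?x] => change (is_true (vge D 0 x)); vg
  | |- context [vge _ _ (_ *+ _)] => apply: vge_nat
  | |- context [vge _ _ (_ + _)] => apply: vgeD; vg
  | |- context [vge _ _ (- _)] => rewrite vgeN; vg
  | |- context [vge _ _ (_ * _)] => solve [apply: vgeZl; vg | apply: vgeZr; vg]
  | |- context [vge _ _ (_ ^+ _)] => solve [apply: vgeX; vg | apply: vgeXl; vg]
  | |- context [vge _ _ 1] => apply: vge_1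
  | |- context [vge _ _ 0] => apply: vge0
  end ].

(** * Valuations of coefficients and the action of GL_2(O_K) *)

Section ValuedQuartics.
Variables (K k : fieldType) (D : dvf K k).
Local Notation v := (dv_v D).
Local Notation pi := (dv_pi D).
Local Notation red := (dv_red D).
Local Notation vge := (vge D).
Implicit Types (F G H : quartic K) (M N U : 'M[K]_2).

(** [Kequiv] and [step] compare values, not coefficients. A polynomial of degree at most 4 vanishing
    at [1, pi, ..., pi ^+ 4] is zero, and these points are distinct because their valuations are. *)
Lemma qeval_inj F G : (forall x z, qeval F x z = qeval G x z) -> F = G.
Proof.
case: F G => [a b c d e] [a' b' c' d' e'] h.
pose s := [:: e - e'; d - d'; c - c'; b - b'; a - a'].
pose P := Poly s.
have rP x : P.[x] = 0.
  have /eqP := h x 1; rewrite -subr_eq0 => /eqP h0; rewrite -[RHS]h0.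
  by rewrite horner_Poly /s /qeval /=; ring.
have P0 : P = 0.
  apply/eqP/negPn/negP => nP.
  pose rs := [seq pi ^+ i | i <- iota 0 5].
  have /(_ nP) := @max_poly_roots _ P rs.
  have -> : all (root P) rs by apply/allP => x _; rewrite /root rP.
  have -> : uniq rs.
    rewrite map_inj_uniq ?iota_uniq // => i j /(congr1 v).
    by rewrite !vX ?dv_pi_neq0 // dv_v_pi; lia.
  by move=> /(_ isT isT); rewrite size_map size_iota ltnNge size_Poly.
have sP i : s`_i = 0 by rewrite -coef_Poly -/P P0 coef0.
have E x y : x - y = 0 :> K -> x = y by move/eqP; rewrite subr_eq0 => /eqP.
by congr Quartic; apply: E;
  [exact: (sP 4)|exact: (sP 3)|exact: (sP 2)|exact: (sP 1)|exact: (sP 0)].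
Qed.

Definition qwge (n4 n3 n2 n1 n0 : int) F : bool :=
  [&& vge n4 (qa F), vge n3 (qb F), vge n2 (qc F), vge n1 (qd F) & vge n0 (qe F)].
Definition qvge n F : bool := qwge n n n n n F.

Lemma qvge0E F : qintegral D F = qvge 0 F.
Proof. by rewrite /qintegral /qvge /qwge /= andbT. Qed.

Lemma qvgeW m n F : qvge n F -> m <= n -> qvge m F.
Proof.
by move=> /and5P[h1 h2 h3 h4 h5] mn; apply/and5P; split; apply: vgeW mn.
Qed.

Lemma nonsingular_neq0 F : nonsingular F -> has (fun c => c != 0) (qcoefs F).
Proof.
apply: contraR; rewrite -all_predC /= !negbK => /and5P[].
case: F => a b c d e /= /eqP-> /eqP-> /eqP-> /eqP-> /andP[/eqP-> _].
by rewrite /discF /wdisc /=; apply/eqP; ring.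
Qed.

Lemma le_foldr_min (n x : int) (s : seq int) :
  (n <= foldr Num.min x s) = (n <= x) && all (fun y => n <= y) s.
Proof.
elim: s => [|y s IH] /=; first by rewrite andbT.
by rewrite le_min IH andbCA.
Qed.

(** Starting the fold at the head of the list repeats an entry and leaves the minimum unchanged. For
    the zero form the list is empty and [vform] takes the default value 0. *)
Lemma le_vform n F : has (fun c => c != 0) (qcoefs F) ->
  (n <= vform D F) = qvge n F.
Proof.
rewrite has_filter /vform => ne0.
have -> : qvge n F = all (vge n) (qcoefs F) by rewrite /qvge /qwge /= andbT.
set s := qcoefs F in ne0 *.
have -> : all (vge n) s = all (fun y => n <= y) [seq v c | c <- s & c != 0].
  rewrite all_map all_filter; apply: eq_all => x /=.
  by rewrite /vge; case: eqP.
rewrite le_foldr_min; case: [seq c <- s | c != 0] ne0 => //= x t _.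
by rewrite andbA andbb.
Qed.

Lemma qvge_subst n F M :
  (forall i j, vge 0 (M i j)) -> qvge n F -> qvge n (qsubst F M).
Proof.
move=> hM; case: F => a b c d e /and5P[/= ha hb hc hd he].
move: (hM 0 0) (hM 0 1) (hM 1 0) (hM 1 1) => h1 h2 h3 h4.
by apply/and5P; rewrite /qsubst /qeval /=; split; vg.
Qed.

Lemma GL2OE M : GL2O D M <-> (forall i j, vge 0 (M i j)) /\ \det M != 0 /\ v (\det M) = 0.
Proof.
split=> [[h1 h2 h3 h4 [h5 h6]]|[h [h5 h6]]]; last by split=> //; apply: h.
split=> // i j; have ord2 (l : 'I_2) : l = 0 \/ l = 1.
  by case: l => -[|[|//]] ?; [left | right]; apply/val_inj.
by case: (ord2 i) => ->; case: (ord2 j) => ->.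
Qed.

Lemma GL2O_mul M N : GL2O D M -> GL2O D N -> GL2O D (M *m N).
Proof.
move=> /GL2OE[hM [M0 vM]] /GL2OE[hN [N0 vN]]; apply/GL2OE; split.
  by move=> i j; rewrite mul_mx22; apply: vgeD; apply: vgeZl.
by rewrite det_mulmx mulf_neq0 // dv_vM // vM vN.
Qed.

Lemma GL2O_inv M : GL2O D M -> exists2 N, GL2O D N & N *m M = 1%:M /\ M *m N = 1%:M.
Proof.
move=> /GL2OE[hM [M0 vM]].
pose u := (\det M)^-1; have u0 : vge 0 u by rewrite vgeE ?invr_eq0 // vV // vM.
move: (hM 0 0) (hM 0 1) (hM 1 0) (hM 1 1) => h1 h2 h3 h4.
exists (mx22 (u * M 1 1) (- u * M 0 1) (- u * M 1 0) (u * M 0 0)).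
  have dE : \det (mx22 (u * M 1 1) (- u * M 0 1) (- u * M 1 0) (u * M 0 0)) = u.
    have : u * \det M = 1 by rewrite mulVf.
    rewrite !det_mx22 !mx22E => E; rewrite -[RHS]mulr1 -E; ring.
  split; rewrite ?mx22E; try by vg.
  by rewrite dE vV // vM invr_eq0.
have uM : u * (M 0 0 * M 1 1 - M 0 1 * M 1 0) = 1 by rewrite -det_mx22 mulVf.
by split; apply: mx22P; rewrite !mul_mx22 !mx22E !mxE /= -?uM; ring.
Qed.

End ValuedQuartics.

(** * Triple roots modulo pi and the passage to pi^-2 F(pi x, z) *)

Ltac red_push := repeat first
  [ rewrite -> redD by vg | rewrite -> redN by vg | rewrite -> redM by vg
  | rewrite -> redX by vg | rewrite -> red_nat ].

Section TripleRoots.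
Variables (K k : fieldType) (D : dvf K k).
Local Notation v := (dv_v D).
Local Notation pi := (dv_pi D).
Local Notation red := (dv_red D).
Local Notation vge := (vge D).
Local Notation qwge := (qwge D).
Local Notation qvge := (qvge D).
Implicit Types (F G H : quartic K) (M N U : 'M[K]_2).

(** The right-hand sides are the coefficients of (z0 X - x0)^3 (p X + q). *)
Lemma triple_root_intro H (x0 z0 p q : k) : (p != 0) || (q != 0) ->
  red (qa H) = z0 ^+ 3 * p ->
  red (qb H) = z0 ^+ 3 * q - 3 * z0 ^+ 2 * x0 * p ->
  red (qc H) = 3 * z0 * x0 ^+ 2 * p - 3 * z0 ^+ 2 * x0 * q ->
  red (qd H) = 3 * z0 * x0 ^+ 2 * q - x0 ^+ 3 * p ->
  red (qe H) = - x0 ^+ 3 * q ->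
  triple_root_at D H x0 z0.
Proof.
move=> pq ha hb hc hd he; exists p, q; split=> //.
rewrite /qred poly_def !big_ord_recl big_ord0 /= ha hb hc hd he /bump /=.
rewrite -!mul_polyC !(rmorphB, rmorphM, rmorphXn, rmorphN, rmorph_nat, rmorphD) /=.
by ring.
Qed.

Lemma triple_root_01 H : triple_root_at D H 0 1 ->
  [/\ red (qc H) = 0, red (qd H) = 0 & red (qe H) = 0].
Proof.
move=> [p [q [_ E]]].
have c0 (i : nat) : (i < 3)%N -> red (qcoef H i 0) = 0.
  move=> i3; have := congr1 (fun P : {poly k} => P`_i) E.
  rewrite /qred coef_poly (leq_trans i3) // => ->.
  by rewrite polyC1 mulr1 polyC0 subr0 coefXnM i3.
by split; [apply: (c0 2) | apply: (c0 1) | apply: (c0 0)].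
Qed.

Lemma qvge_scale_pi n m F : qvge m (qscale (pi ^ (- n)) F) = qvge (m + n) F.
Proof.
have p0 : pi ^ (- n) != 0 by rewrite expfz_neq0 ?dv_pi_neq0.
by rewrite /qvge /qwge /qscale /= !vgeM_l // vpiz opprK.
Qed.

(** Written with multiplier [pi^-1] squared and a matrix of determinant [pi], whose product is 1:
    this is why discriminant and level survive. The coefficient of x^i z^(4-i) gets multiplied by
    pi^(i-2). *)
Definition descend F := qscale (pi ^- 2) (qsubst F (mx22 pi 0 0 1)).

Lemma descendE F : descend F =
  Quartic (pi ^+ 2 * qa F) (pi * qb F) (qc F) (pi ^-1 * qd F) (pi ^- 2 * qe F).
Proof.
have p0 := dv_pi_neq0 D; case: F => a b c d e.
rewrite /descend /qscale /qsubst /qeval /= !mx22E.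
by congr Quartic; field; rewrite ?p0 ?oner_eq0.
Qed.

Lemma qwge_descend n4 n3 n2 n1 n0 F :
  qwge n4 n3 n2 n1 n0 (descend F) = qwge (n4 - 2) (n3 - 1) n2 (n1 + 1) (n0 + 2) F.
Proof.
have p0 := dv_pi_neq0 D.
rewrite descendE /qwge /= !vgeM_l ?invr_eq0 ?expf_neq0 //.
by rewrite !vV ?expf_neq0 // !vX // dv_v_pi !opprK.
Qed.

Lemma GL2O_int M : GL2O D M -> forall i j, vge 0 (M i j).
Proof. by case/GL2OE. Qed.

(** The triple root at (0 : 1) kills the last three coefficients of pi^-n G modulo pi, which gains 1
    in their bounds. *)
Lemma stepE F M G F' : step D F M G F' -> qvge (vform D F) F ->
  [/\ GL2O D M, G = qsubst F M, F' = descend G &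
      let n := vform D F in qwge n n (n + 1) (n + 1) (n + 1) G].
Proof.
move=> [hM hG hT hF'] Fn; have EG : G = qsubst F M.
  by apply: (qeval_inj D) => x z; rewrite hG qeval_subst.
split=> //.
  apply: (qeval_inj D) => x z; rewrite hF' /descend qeval_scale qeval_subst !mx22E.
  by congr (_ * qeval _ _ _); ring.
have hG' : qvge (vform D F) G by rewrite EG; apply: qvge_subst Fn; apply: GL2O_int.
set n := vform D F in hG' hT *; move: (hG').
have p0 : pi ^ (- n) != 0 by rewrite expfz_neq0 ?dv_pi_neq0.
have [] := triple_root_01 hT; rewrite /= /qwge.
move=> hc hd he /and5P[ha hb ic id ie]; apply/and5P.
have K1 x : vge n x -> red (pi ^ (- n) * x) = 0 -> vge (n + 1) x.
  move=> hx /eqP; rewrite red_eq0 vgeM_l // vpiz opprK //; first by rewrite addrC.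
  by rewrite add0r.
by split=> //; apply: K1.
Qed.

Lemma qvge_GL2O n F M : GL2O D M -> qvge n (qsubst F M) = qvge n F.
Proof.
move=> hM; apply/idP/idP; last by apply: qvge_subst; apply: GL2O_int.
have [N hN [NM _]] := GL2O_inv hM.
move=> h; rewrite -(qsubst1 F) -NM -qsubst_mul.
by apply: qvge_subst h; apply: GL2O_int.
Qed.

(* Uniqueness of the triple root (0 : 1): a change of variables preserving it is lower
   triangular modulo [pi]. *)
Lemma triple_root_unique n H N : GL2O D N ->
  qwge n n (n + 1) (n + 1) (n + 1) H ->
  qwge n n (n + 1) (n + 1) (n + 1) (qsubst H N) ->
  ~~ qvge (n + 1) H -> vge 1 (N 1 0).
Proof.
move=> /GL2OE[hN [N0 vN]]; case: H => a b c d e.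
move=> /and5P[/= ha hb hc hd he] /and5P[_ _ _ /= hd' he'].
move: (hN 0 0) (hN 0 1) (hN 1 0) (hN 1 1) N0 vN; rewrite det_mx22.
set p := N 0 0 in hd' he' *; set q := N 0 1 in hd' he' *.
set r := N 1 0 in hd' he' *; set t := N 1 1 in hd' he' *.
(* Modulo pi^(n+1), [H] is x^3 (a x + b z). If [r] were a unit, the last two coefficients after
   substitution would force [a * r + b * t] and [a * p + b * q] to vanish, and the unit determinant
   would then kill [a] and [b]. *)
move=> hp hq hr ht N0 vN; apply: contraR => r1.
have [r0 vr] := vgePn hr r1.
have unit_r x : vge (n + 1) (r ^+ 3 * x) -> vge (n + 1) x.
  by rewrite vgeM_l ?expf_neq0 // vX // vr mul0r subr0.
have unit_det x : vge (n + 1) ((p * t - q * r) * x) -> vge (n + 1) x.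
  by rewrite vgeM_l // vN subr0.
have h1 : vge (n + 1) (a * r + b * t).
  apply: unit_r.
  have -> : r ^+ 3 * (a * r + b * t) = qeval (Quartic a b c d e) r t
     - (c * (r ^+ 2 * t ^+ 2) + d * (r * t ^+ 3) + e * t ^+ 4) by rewrite /qeval /=; ring.
  by apply: vgeD he' _; vg.
have h2 : vge (n + 1) (a * p + b * q).
  apply: unit_r.
  have -> : r ^+ 3 * (a * p + b * q) = (4 * a * p * r ^+ 3 +
     b * (r ^+ 3 * q + 3 * p * r ^+ 2 * t) +
     c * (2 * p * r * t ^+ 2 + 2 * r ^+ 2 * q * t) +
     d * (p * t ^+ 3 + 3 * r * q * t ^+ 2) + 4 * e * q * t ^+ 3)
     - (3 * p * r ^+ 2 * (a * r + b * t) + c * (2 * p * r * t ^+ 2 + 2 * r ^+ 2 * q * t) +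
     d * (p * t ^+ 3 + 3 * r * q * t ^+ 2) + 4 * e * q * t ^+ 3) by ring.
  by apply: vgeD hd' _; vg.
apply/and5P; split=> //=; apply: unit_det.
  have -> : (p * t - q * r) * a = t * (a * p + b * q) - q * (a * r + b * t) by ring.
  by vg.
have -> : (p * t - q * r) * b = p * (a * r + b * t) - r * (a * p + b * q) by ring.
by vg.
Qed.

(** Conjugating [N] by diag(pi, 1) divides its lower left entry by pi, so the result is integral
    exactly because that entry is divisible by pi. *)
Lemma descend_subst H N : GL2O D N -> vge 1 (N 1 0) ->
  exists2 N', GL2O D N' & descend (qsubst H N) = qsubst (descend H) N'.
Proof.
move=> /GL2OE[hN [N0 vN]] r1; have p0 := dv_pi_neq0 D.
exists (mx22 (N 0 0) (pi * N 0 1) (pi^-1 * N 1 0) (N 1 1)); last first.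
  rewrite /descend qsubst_scale !qsubst_mul; congr (qscale _ (qsubst _ _)).
  by apply: mx22P; rewrite !mul_mx22 !mx22E; field; rewrite ?p0 ?oner_eq0.
have dE : \det (mx22 (N 0 0) (pi * N 0 1) (pi^-1 * N 1 0) (N 1 1)) = \det N.
  by rewrite !det_mx22 !mx22E; field; rewrite ?p0 ?oner_eq0.
have pi1 : vge 0 pi by rewrite vgeE // dv_v_pi.
split; rewrite ?mx22E ?dE //; try exact: hN.
  by apply: vgeZl => //; apply: hN.
by change (is_true (vge 0 (pi^-1 * N 1 0))); rewrite vgeM_l ?invr_eq0 // vV // dv_v_pi.
Qed.

(** Modulo pi, [H] is x^3 (a x + b z). Substituting turns x into p x + r z, which vanishes at (-r :
    p), and the linear factor into (a p + b q) x + (a r + b t) z. *)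
Lemma triple_root_subst H V : GL2O D V -> qwge 0 0 1 1 1 H -> ~~ qvge 1 H ->
  has_triple_root D (qsubst H V).
Proof.
move=> /GL2OE[hV [V0 vV0]]; case: H => a b c d e /and5P[/= ha hb hc hd he] nH.
move: (hV 0 0) (hV 0 1) (hV 1 0) (hV 1 1) V0 vV0; rewrite det_mx22.
pose p := V 0 0; pose q := V 0 1; pose r := V 1 0; pose t := V 1 1.
rewrite -/p -/q -/r -/t => hp hq hr ht V0 vV0.
have unit_det x : vge 1 ((p * t - q * r) * x) -> vge 1 x.
  by rewrite vgeM_l // vV0 subr0.
exists (- red r), (red p); split.
  rewrite oppr_eq0 !red_eq0 // -negb_and; apply/negP => /andP[r1 p1].
  have : vge 1 ((p * t - q * r) * 1) by vg.
  by move/unit_det; rewrite vgeE ?oner_eq0 // v1.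
have hpq : vge 0 (a * p + b * q) by vg.
have hrt : vge 0 (a * r + b * t) by vg.
have [rc rd re] : [/\ red c = 0, red d = 0 & red e = 0].
  by split; apply/eqP; rewrite red_eq0 // (vgeW hc, vgeW hd, vgeW he).
apply: (@triple_root_intro _ _ _ (red (a * p + b * q)) (red (a * r + b * t))).
- rewrite !red_eq0 // -negb_and; apply: contra nH => /andP[h1 h2].
  apply/and5P; split=> //=; apply: unit_det.
    have -> : (p * t - q * r) * a = t * (a * p + b * q) - q * (a * r + b * t) by ring.
    by vg.
  have -> : (p * t - q * r) * b = p * (a * r + b * t) - r * (a * p + b * q) by ring.
  by vg.
all: have [ic id ie] : [/\ vge 0 c, vge 0 d & vge 0 e]
  by split; [apply: vgeW hc _ | apply: vgeW hd _ | apply: vgeW he _].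
all: rewrite /qsubst /qeval /= -/p -/q -/r -/t; red_push; rewrite rc rd re; ring.
Qed.

End TripleRoots.

(** * Smith normal form and the shape of non-minimal quartics *)

Section NonMinimal.
Variables (K k : fieldType) (D : dvf K k).
Local Notation v := (dv_v D).
Local Notation pi := (dv_pi D).
Local Notation vge := (vge D).
Local Notation qwge := (qwge D).
Local Notation qvge := (qvge D).
Implicit Types (F G H : quartic K) (M N U : 'M[K]_2).

Lemma min_entry M : M != 0 ->
  exists i j, M i j != 0 /\ forall i' j', vge (v (M i j)) (M i' j').
Proof.
move=> M0; have [[i0 j0] /= h0] : exists ij : 'I_2 * 'I_2, M ij.1 ij.2 != 0.
  apply/existsP; apply: contraR M0; rewrite negb_exists => /forallP h.
  by apply/eqP/matrixP => i j; rewrite mxE; have := h (i, j); rewrite negbK => /eqP.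
have h0' : M (i0, j0).1 (i0, j0).2 != 0 by [].
case: (@arg_minP _ int _ (i0, j0) (fun ij => M ij.1 ij.2 != 0)
         (fun ij => v (M ij.1 ij.2)) h0') => -[i j] /= Mij hmin.
exists i, j; split=> // i' j'; rewrite /vge.
by case: eqVneq => //= h; apply: (hmin (i', j')).
Qed.

Definition swap22 : 'M[K]_2 := mx22 0 1 1 0.

Lemma swap22K : swap22 *m swap22 = 1%:M.
Proof. by apply: mx22P; rewrite mul_mx22 !mx22E !mxE /=; ring. Qed.

Lemma GL2O_swap22 : GL2O D swap22.
Proof.
have dE : \det swap22 = -1 by rewrite det_mx22 !mx22E; ring.
split; rewrite ?mx22E; [exact: vge0|exact: vge_1|exact: vge_1|exact: vge0|].
by rewrite dE vN1 oppr_eq0 oner_eq0.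
Qed.

Lemma GL2O_1 : GL2O D 1%:M.
Proof. by rewrite -swap22K; apply: GL2O_mul; exact: GL2O_swap22. Qed.

Lemma swap_to_11 (i : 'I_2) : exists S : 'M[K]_2, [/\ GL2O D S, S *m S = 1%:M,
  forall M j, (S *m M) 1 j = M i j & forall M j, (M *m S) j 1 = M j i].
Proof.
case: i => -[|[|//]] hi.
  have -> : Ordinal hi = 0 by apply/val_inj.
  exists swap22; split; [exact: GL2O_swap22|exact: swap22K| |] => M j;
  by rewrite mul_mx22 !mx22E; ring.
have -> : Ordinal hi = 1 by apply/val_inj.
by exists 1%:M; split; [exact: GL2O_1|rewrite mul1mx| |] => // M j; rewrite ?mul1mx ?mulmx1.
Qed.

(** An entry of least valuation is moved to the lower right corner; the quotients of the other
    entries by it are integral, so unitriangular matrices clear its row and column. *)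
Lemma Smith22 M : \det M != 0 -> exists L U p t,
  [/\ GL2O D L, GL2O D U, M = L *m mx22 p 0 0 t *m U, p != 0 /\ t != 0 & v t <= v p].
Proof.
wlog [h0 hmin] : M / M 1 1 != 0 /\ forall i j, vge (v (M 1 1)) (M i j) => [W d0|].
  have M0 : M != 0.
    by apply: contraNneq d0 => ->; rewrite det_mx22 !mxE mul0r subr0.
  have [i [j [Mij hmin]]] := min_entry M0.
  have [A [hA AA A1 _]] := swap_to_11 i; have [B [hB BB _ B1]] := swap_to_11 j.
  have E11 : (A *m M *m B) 1 1 = M i j by rewrite B1 A1.
  have AMB i' j' : vge (v (M i j)) ((A *m M *m B) i' j').
    move/GL2O_int: hA => hA; move/GL2O_int: hB => hB.
    rewrite !mul_mx22; apply: vgeD; (apply: vgeZr; last exact: hB);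
    by apply: vgeD; apply: vgeZl; rewrite ?hA ?hmin.
  have [||L [U [p [t [hL hU E pt vtp]]]]] := W (A *m M *m B).
  - by rewrite E11.
  - have unit_det S : GL2O D S -> \det S != 0 by case/GL2OE => _ [].
    by rewrite !det_mulmx; do !apply: mulf_neq0 => //; apply: unit_det.
  exists (A *m L), (U *m B), p, t; split=> //; try exact: GL2O_mul.
  transitivity (A *m (L *m mx22 p 0 0 t *m U) *m B); last by rewrite !mulmxA.
  by rewrite -E !mulmxA AA mul1mx -mulmxA BB mulmx1.
rewrite det_mx22 => d0; have int_div x : vge (v (M 1 1)) x -> vge 0 (x / M 1 1).
  by move=> h; rewrite vgeM_r ?invr_eq0 // vV // sub0r opprK.
(* The determinant divided by the pivot is what elimination leaves in the upper left corner. *)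
pose p := (M 0 0 * M 1 1 - M 0 1 * M 1 0) / M 1 1.
have p0 : p != 0 by rewrite mulf_neq0 ?invr_eq0.
exists (mx22 1 (M 0 1 / M 1 1) 0 1), (mx22 1 0 (M 1 0 / M 1 1) 1), p, (M 1 1).
have GL2O_unitri x y : vge 0 x -> vge 0 y -> x * y = 0 -> GL2O D (mx22 1 x y 1).
  move=> hx hy xy0; have dE : \det (mx22 1 x y 1) = 1 by rewrite det_mx22 !mx22E xy0; ring.
  by split; rewrite ?mx22E ?dE ?v1 ?oner_eq0 //; apply: vge_1.
split=> //.
- by apply: GL2O_unitri; rewrite ?mulr0 ?vge0 // int_div.
- by apply: GL2O_unitri; rewrite ?mul0r ?vge0 // int_div.
- by apply: mx22P; rewrite !mul_mx22 !mx22E /p; field; rewrite ?h0 ?oner_eq0.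
suff : vge (v (M 1 1)) p by rewrite vgeE.
have -> : p = M 0 0 - M 0 1 * (M 1 0 / M 1 1) by rewrite /p; field; rewrite ?h0 ?oner_eq0.
by apply: vgeD => //; rewrite vgeN; apply: vgeZr => //; apply: int_div.
Qed.

(* After [Smith22] the smaller model arises from a diagonal substitution [diag (p, t)] and
   a factor [mu ^+ 2]; with [s = v p - v t], the drop of the discriminant forces
   [v (coefficient of x^i z^(4-i)) >= 2 + 2 s - s i]. *)
Lemma nonminimal_weights F : nonsingular F -> qvge 0 F -> nonminimal D F -> ~~ qvge 2 F ->
  exists2 U, GL2O D U &
    qwge 0 1 2 3 4 (qsubst F U) \/ qwge 0 0 2 4 6 (qsubst F U).
Proof.
move=> nsF iF [F' [iF' [[mu [M [mu0 [M0 EF']]]] vF']]] n2.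
have {}EF' : F' = qscale (mu ^+ 2) (qsubst F M).
  by apply: (qeval_inj D) => x z; rewrite qeval_scale qeval_subst.
have [L [U [p [t [hL hU EM [p0 t0] vtp]]]]] := Smith22 M0.
have [L' hL' [L'L _]] := GL2O_inv hL.
have vM : v (\det M) = v p + v t.
  move/GL2OE: hL => [_ [dL vL]]; move/GL2OE: hU => [_ [dU vU]].
  have dE : \det (mx22 p 0 0 t) = p * t by rewrite det_mx22 !mx22E; ring.
  by rewrite EM !det_mulmx dE !dv_vM ?mulf_neq0 // vL vU; vlia.
(* The discriminant is multiplied by the 12th power of [mu * \det M], so a drop makes this valuation
   negative. *)
have hs : v mu + v p + v t <= -1.
  move: vF'; rewrite EF' discF_subst // dv_vM ?expf_neq0 ?mulf_neq0 //.
  by rewrite vX ?mulf_neq0 // dv_vM // vM; vlia.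
exists U => //; have iH : qvge 0 (qsubst F U) by rewrite qvge_GL2O.
(* Undoing [L] keeps [F'] integral and leaves a purely diagonal substitution in [qsubst F U]. *)
have : qvge 0 (qsubst F' L').
  by rewrite qvge_GL2O // -qvge0E.
rewrite EF' qsubst_scale qsubst_mul EM !mulmxA L'L mul1mx -qsubst_mul.
rewrite -(qvge_GL2O 2 F hU) in n2.
move: iH n2; case: (qsubst F U) => a b c d e.
rewrite /qvge /qwge /qsubst /qscale /qeval /= !mx22E => /and5P[ia ib ic id ie] n2.
have -> : mu ^+ 2 * (a * p ^+ 4 + b * p ^+ 3 * 0 + c * p ^+ 2 * 0 ^+ 2
   + d * p * 0 ^+ 3 + e * 0 ^+ 4)
  = mu ^+ 2 * p ^+ 4 * a by ring.
have -> : mu ^+ 2 * (4 * a * p ^+ 3 * 0 + b * (p ^+ 3 * t + 3 * p ^+ 2 * 0 * 0) +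
   c * (2 * p ^+ 2 * 0 * t + 2 * p * 0 * 0 ^+ 2) + d * (3 * p * 0 ^+ 2 * t + 0 * 0 ^+ 3) +
   4 * e * 0 ^+ 3 * t) = mu ^+ 2 * (p ^+ 3 * t) * b by ring.
have -> : mu ^+ 2 * (6 * a * p ^+ 2 * 0 ^+ 2 + b * (3 * p * 0 ^+ 2 * 0 + 3 * p ^+ 2 * 0 * t) +
   c * (p ^+ 2 * t ^+ 2 + 4 * p * 0 * 0 * t + 0 ^+ 2 * 0 ^+ 2) +
   d * (3 * p * 0 * t ^+ 2 + 3 * 0 * 0 ^+ 2 * t) + 6 * e * 0 ^+ 2 * t ^+ 2)
  = mu ^+ 2 * (p ^+ 2 * t ^+ 2) * c by ring.
have -> : mu ^+ 2 * (4 * a * p * 0 ^+ 3 + b * (0 ^+ 3 * 0 + 3 * p * 0 ^+ 2 * t) +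
   c * (2 * p * 0 * t ^+ 2 + 2 * 0 ^+ 2 * 0 * t) + d * (p * t ^+ 3 + 3 * 0 * 0 * t ^+ 2) +
   4 * e * 0 * t ^+ 3) = mu ^+ 2 * (p * t ^+ 3) * d by ring.
have -> : mu ^+ 2 * (a * 0 ^+ 4 + b * 0 ^+ 3 * t + c * 0 ^+ 2 * t ^+ 2
   + d * 0 * t ^+ 3 + e * t ^+ 4)
  = mu ^+ 2 * t ^+ 4 * e by ring.
rewrite !vgeM_l ?mulf_neq0 ?expf_neq0 // !dv_vM ?mulf_neq0 ?expf_neq0 // ?vX //.
move=> /and5P[ja jb jc jd je].
(* For s = 0 all bounds are 2, against [n2]; s = 1 gives (0,1,2,3,4); s >= 2 gives (0,0,2,4,6), the
   two zeros coming from integrality. *)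
have [s0|s0] := eqVneq (v p) (v t).
  by case/negP: n2; apply/and5P; split; [apply: vgeW ja _ | apply: vgeW jb _ | apply: vgeW jc _
    | apply: vgeW jd _ | apply: vgeW je _]; move: hs vtp s0; clear; vlia.
have [s1|s1] := eqVneq (v p) (v t + 1); [left | right].
  by apply/and5P; split=> //; [apply: vgeW jb _ | apply: vgeW jc _
    | apply: vgeW jd _ | apply: vgeW je _]; move: hs vtp s0 s1; clear; vlia.
by apply/and5P; split=> //; [apply: vgeW jc _ | apply: vgeW jd _ | apply: vgeW je _];
move: hs vtp s0 s1; clear; vlia.
Qed.

End NonMinimal.

(** * Quartics over k whose resolvent cubic is a perfect cube *)

Section Cuspidal.
Variable k : fieldType.

(* In characteristic 3 the conditions give [c = 0] and [b d = a e], so the form is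
   [(a x + b z) (x^3 + delta z^3)] and a cube root of [delta] is needed; otherwise the
   triple root is found after completing the fourth power. *)
Lemma cuspidal_triple_root (a b c d e r : k) :
  2 != 0 :> k -> (3 = 0 :> k -> forall y : k, exists z, z ^+ 3 = y) ->
  c + 3 * r = 0 ->
  b * d - 4 * a * e + 2 * r * c + 3 * r ^+ 2 = 0 ->
  a * d ^+ 2 + b ^+ 2 * e - 4 * a * c * e + r * (b * d - 4 * a * e)
    + r ^+ 2 * c + r ^+ 3 = 0 ->
  exists x0 z0 p q, ((x0 != 0) || (z0 != 0)) /\
  [/\ a = z0 ^+ 3 * p, b = z0 ^+ 3 * q - 3 * z0 ^+ 2 * x0 * p,
      c = 3 * z0 * x0 ^+ 2 * p - 3 * z0 ^+ 2 * x0 * q,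
      d = 3 * z0 * x0 ^+ 2 * q - x0 ^+ 3 * p & e = - x0 ^+ 3 * q].
Proof.
move=> n2 cube3 h1 h2 h3.
(* The form is z^3 (d x + e z), with its triple root at infinity. *)
have top0 : a = 0 -> b = 0 -> c = 0 -> exists x0 z0 p q, ((x0 != 0) || (z0 != 0)) /\
  [/\ a = z0 ^+ 3 * p, b = z0 ^+ 3 * q - 3 * z0 ^+ 2 * x0 * p,
      c = 3 * z0 * x0 ^+ 2 * p - 3 * z0 ^+ 2 * x0 * q,
      d = 3 * z0 * x0 ^+ 2 * q - x0 ^+ 3 * p & e = - x0 ^+ 3 * q].
  move=> -> -> ->; exists (-1), 0, d, e; rewrite oppr_eq0 oner_eq0; split=> //.
  by split; ring.
have [e3|n3] := eqVneq (3 : k) 0.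
  have c0 : c = 0 by rewrite -h1 e3; ring.
  have h : a * e = b * d.
    have -> : a * e = b * d - (b * d - 4 * a * e + 2 * r * c + 3 * r ^+ 2)
      + 3 * (r ^+ 2 - a * e) + 2 * r * c by ring.
    by rewrite h2 e3 c0; ring.
  have [a0|na] := eqVneq a 0; last first.
    have [w wE] := cube3 e3 (d / a).
    exists (- w), 1, a, b; rewrite oner_eq0 orbT; split=> //.
    have -> : c = 0 by []. rewrite e3.
    have dE : d = a * w ^+ 3 by rewrite wE; field.
    split; try by ring.
      by rewrite {1}dE; ring.
    by apply: (mulfI na); rewrite h dE; ring.
  have [b0|nb] := eqVneq b 0; first exact: top0.
  have d0 : d = 0 by move/eqP: h; rewrite a0 mul0r eq_sym mulf_eq0 (negPf nb) => /eqP.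
  have [w wE] := cube3 e3 (e / b).
  exists (- w), 1, a, b; rewrite oner_eq0 orbT; split=> //.
  have eE : e = b * w ^+ 3 by rewrite wE; field.
  rewrite c0 d0 a0 e3 {1}eE; split; ring.
have n4 : 4 != 0 :> k by rewrite (_ : 4 = 2 * 2) ?mulf_neq0 //; ring.
(* Shifting the cubic by -c/3 turns its remaining coefficients into -I/3 and -J/27, so both
   invariants vanish. *)
have rE : r = - c / 3.
  apply: (mulfI n3); move/eqP: h1; rewrite addrC addr_eq0 => /eqP ->; field.
  exact: n3.
have hI : 12 * a * e - 3 * b * d + c ^+ 2 = 0.
  apply/eqP; rewrite -oppr_eq0 -(mulr0 3) -h2 rE; apply/eqP; field.
  exact: n3.
have hJ : 72 * a * c * e - 27 * a * d ^+ 2 - 27 * b ^+ 2 * e + 9 * b * c * d - 2 * c ^+ 3 = 0.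
  apply/eqP; rewrite -oppr_eq0 -(mulr0 27) -h3 rE; apply/eqP; field.
  exact: n3.
have [a0|na] := eqVneq a 0.
  have [b0|nb] := eqVneq b 0.
    apply: top0 => //; apply/eqP; rewrite -sqrf_eq0 -hI a0 b0; apply/eqP; ring.
  (* The form is z times a cubic, and I = J = 0 makes the cubic b (x + c/(3b) z)^3. *)
  exists (- (c / (3 * b))), 1, 0, b; rewrite oner_eq0 orbT; split=> //.
  have dE : d = c ^+ 2 / (3 * b).
    apply: (mulfI (mulf_neq0 n3 nb)); apply/eqP; rewrite -subr_eq0 -oppr_eq0 -hI a0.
    by apply/eqP; field; rewrite ?n3 ?nb.
  have n27 : 27 != 0 :> k by rewrite (_ : 27 = 3 * 3 * 3) ?mulf_neq0 //; ring.
  have eE : e = c ^+ 3 / (27 * b ^+ 2).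
    apply: (mulfI (mulf_neq0 n27 (expf_neq0 2 nb)));
      apply/eqP; rewrite -subr_eq0 -oppr_eq0 -hJ a0 dE.
    by apply/eqP; field; rewrite ?n3 ?nb ?n27.
  rewrite dE eE a0; split; field; rewrite ?n3 ?nb ?n27 //.
(* In y = x + B z the form becomes a y^4 + c' y^2 z^2 + d' y z^3 + e' z^4. *)
pose B := b / (4 * a).
pose c' := c - 6 * a * B ^+ 2; pose d' := d - 4 * a * B ^+ 3 - 2 * c' * B.
pose e' := e - a * B ^+ 4 - c' * B ^+ 2 - d' * B.
have bE : b = 4 * a * B by rewrite /B; field; rewrite ?n4 ?na.
have cE : c = 6 * a * B ^+ 2 + c' by rewrite /c'; ring.
have dE : d = 4 * a * B ^+ 3 + 2 * c' * B + d' by rewrite /d'; ring.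
have eE : e = a * B ^+ 4 + c' * B ^+ 2 + d' * B + e' by rewrite /e'; ring.
clearbody B c' d' e'.
move: hI hJ; rewrite bE cE dE eE => hI hJ.
have hI' : 12 * a * e' = - c' ^+ 2.
  by apply/eqP; rewrite -subr_eq0 -hI; apply/eqP; ring.
have hJ' : 27 * a * d' ^+ 2 = - 8 * c' ^+ 3.
  apply/eqP; rewrite -subr_eq0 -oppr_eq0 -hJ -(addr0 (- _)) -(subrr (6 * c' * (12 * a * e'))).
  by rewrite {2}hI'; apply/eqP; ring.
have n16 : 16 != 0 :> k by rewrite (_ : 16 = 4 * 4) ?mulf_neq0 //; ring.
have n64 : 64 != 0 :> k by rewrite (_ : 64 = 16 * 4) ?mulf_neq0 //; ring.
(* A triple root y = A z means a (y - A z)^3 (y + 3 A z), with c' = -6 a A^2 and d' = 8 a A^3; the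
   quotient gives A. If c' = 0 then d' = 0, and division by zero returns the correct A = 0. *)
pose A := - (3 * d' / (4 * c')).
have n27 : 27 != 0 :> k by rewrite (_ : 27 = 3 * 3 * 3) ?mulf_neq0 //; ring.
have n12 : 12 != 0 :> k by rewrite (_ : 12 = 3 * 4) ?mulf_neq0 //; ring.
have [hc hd] : c' = - 6 * a * A ^+ 2 /\ d' = 8 * a * A ^+ 3.
  have [c0|nc] := eqVneq c' 0.
    have -> : A = 0 by rewrite /A c0 mulr0 invr0 mulr0 oppr0.
    move/eqP: hJ'; rewrite c0 expr0n mulr0 mulf_eq0 mulf_eq0 (negPf n27) (negPf na) /=.
    by rewrite sqrf_eq0 => /eqP ->; split; ring.
  have aE : a * d' ^+ 2 = - 8 * c' ^+ 3 / 27 by apply: (mulfI n27); rewrite mulrA hJ'; field.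
  split.
    have -> : - 6 * a * A ^+ 2 = - 54 * (a * d' ^+ 2) / (4 ^+ 2 * c' ^+ 2).
      by rewrite /A; field; rewrite ?n4 ?n16 ?n64 ?nc.
    by rewrite aE; field; rewrite ?n4 ?n16 ?n64 ?n27 ?nc.
  have -> : 8 * a * A ^+ 3 = - 27 * 8 * (a * d' ^+ 2) * d' / (4 ^+ 3 * c' ^+ 3).
    by rewrite /A; field; rewrite ?n4 ?n16 ?n64 ?nc.
  by rewrite aE; field; rewrite ?n4 ?n16 ?n64 ?n27 ?nc.
have he : e' = - 3 * a * A ^+ 4.
  by apply: (mulfI (mulf_neq0 n12 na)); rewrite hI' hc; ring.
clearbody A.
exists (A - B), 1, a, (a * (B + 3 * A)); rewrite oner_eq0 orbT; split=> //.
by rewrite hc hd he; split; ring.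
Qed.

End Cuspidal.

(** * The level and the resolvent cubic *)

Section Level.
Variables (K k : fieldType) (D : dvf K k).
Local Notation v := (dv_v D).
Local Notation pi := (dv_pi D).
Local Notation red := (dv_red D).
Local Notation vge := (vge D).
Local Notation qwge := (qwge D).
Local Notation qvge := (qvge D).
Implicit Types (F G H : quartic K) (M N U : 'M[K]_2).

(** The Jacobian keeps its isomorphism class, so both forms share their minimal models, and the
    discriminant changes by the 12th power of a unit. *)
Lemma is_level_subst F M m l : m != 0 -> \det M != 0 -> v (m * \det M) = 0 ->
  nonsingular F -> is_level D F l <-> is_level D (qscale (m ^+ 2) (qsubst F M)) l.
Proof.
move=> m0 M0 vmM nsF; have [r rE] := jacW_subst F m0 M0.
set F' := qscale _ _ in rE *.
have iFF' : wiso (jacW F) (jacW F').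
  by exists (m * \det M)^-1, r, 0, 0; rewrite invr_eq0 mulf_neq0.
have vdE : v (discF F') = v (discF F).
  by rewrite discF_subst // dv_vM ?expf_neq0 ?mulf_neq0 // vX ?mulf_neq0 // vmM mul0r add0r.
have isoE W : wiso (jacW F) W <-> wiso (jacW F') W.
  by split; apply: wiso_trans => //; apply: wiso_sym.
by split=> -[W [iW [/isoE hW [min vE]]]]; exists W; split=> //; split=> //; split;
  [ move=> W' iW' /isoE; apply: min | rewrite ?vdE // -vdE
  | move=> W' iW' /isoE; apply: min | rewrite -?vdE // vdE].
Qed.

Lemma qscale1 F : qscale 1 F = F.
Proof. by case: F => a b c d e; rewrite /qscale /= !mul1r. Qed.

Lemma nonsingular_GL2O F M : GL2O D M -> nonsingular F -> nonsingular (qsubst F M).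
Proof.
case/GL2OE=> _ [M0 _] nsF; rewrite -(qscale1 (qsubst F M)) -(expr1n _ 2).
by rewrite /nonsingular discF_subst ?oner_eq0 // mulf_neq0 ?expf_neq0 ?mulf_neq0 ?oner_eq0.
Qed.

Lemma is_level_GL2O F M l : GL2O D M -> nonsingular F ->
  is_level D F l <-> is_level D (qsubst F M) l.
Proof.
case/GL2OE=> _ [M0 vM] nsF; rewrite -[X in _ <-> is_level D X _]qscale1 -(expr1n _ 2).
by apply: is_level_subst; rewrite ?oner_eq0 ?mul1r.
Qed.

Lemma det_diag_pi : \det (mx22 pi 0 0 1) = pi.
Proof. by rewrite det_mx22 !mx22E; ring. Qed.

Lemma nonsingular_descend F : nonsingular F -> nonsingular (descend D F).
Proof.
move=> nsF; rewrite /nonsingular /descend -exprVn.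
rewrite discF_subst ?det_diag_pi ?invr_eq0 ?dv_pi_neq0 //.
by rewrite mulf_neq0 ?expf_neq0 ?mulf_neq0 ?invr_eq0 ?dv_pi_neq0.
Qed.

Lemma is_level_descend F l : nonsingular F -> is_level D F l <-> is_level D (descend D F) l.
Proof.
have p0 := dv_pi_neq0 D.
move=> nsF; rewrite /descend -exprVn.
by apply: is_level_subst; rewrite ?det_diag_pi ?invr_eq0 // mulVf // v1.
Qed.

Lemma Kequiv_descend F M : \det M != 0 -> Kequiv F (descend D (qsubst F M)).
Proof.
have p0 := dv_pi_neq0 D.
move=> M0; exists pi^-1, (mx22 pi 0 0 1 *m M).
rewrite invr_eq0 det_mulmx det_diag_pi mulf_neq0 //.
by split=> //; split=> // x z; rewrite /descend qeval_scale qsubst_mul qeval_subst exprVn.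
Qed.

(** If v(r) were negative, dividing the cubic by r^3 would write 1 as an element of positive
    valuation. *)
Lemma vge_monic_root c a4 a6 r : vge 0 c -> vge 0 a4 -> vge 0 a6 ->
  vge 0 (a6 + r * a4 + r ^+ 2 * c + r ^+ 3) -> vge 0 r.
Proof.
move=> hc h4 h6 hf; apply: contraT => nr.
have r0 : r != 0 by apply: contraNneq nr => ->; apply: vge0.
have s1 : vge 1 r^-1.
  by move: nr; rewrite !vgeE ?invr_eq0 // vV //; vlia.
have s0 : vge 0 r^-1 by apply: vgeW s1 _.
have : vge 1 1; last by rewrite vgeE ?oner_eq0 // v1.
have -> : 1 = r^-1 ^+ 3 * (a6 + r * a4 + r ^+ 2 * c + r ^+ 3)
   - (r^-1 * c + r^-1 ^+ 2 * a4 + r^-1 ^+ 3 * a6) by field.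
by vg.
Qed.

Lemma two_unit : 2%N \notin [pchar k] -> 2 != 0 :> K /\ v 2 = 0.
Proof.
move=> n2; apply: vgePn (vge_nat D 2) _.
by rewrite -red_eq0 ?vge_nat // red_nat; apply: contra n2 => e2; rewrite inE.
Qed.

(* Completing the square in a minimal Weierstrass equation: [x = r] is a triple zero, to
   the stated precision, of the resolvent cubic. *)
Lemma pos_level_resolvent F l : 2%N \notin [pchar k] -> nonsingular F ->
  is_level D F l -> 0 < l ->
  exists r, let W := jacW F in
    [/\ vge 2 (wa2 W + 3 * r),
        vge 4 (wa4 W + 2 * r * wa2 W + 3 * r ^+ 2) &
        vge 6 (wa6 W + r * wa4 W + r ^+ 2 * wa2 W + r ^+ 3)].
Proof.
move=> n2 nsF [W0 [iW [[u [r [s [t [u0 EW]]]]] [_ vE]]]] l0.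
have [two0 v2] := two_unit n2.
(* Comparing discriminants shows that v(u) equals the level. *)
have u1 : 1 <= v u.
  move: vE; rewrite EW wdisc_trans // dv_vM ?invr_eq0 ?expf_neq0 // vV ?expf_neq0 // vX //.
  by rewrite /discF; move: l0; clear; vlia.
exists r; move: EW iW; rewrite /wtrans /jacW /=.
case: W0 vE => a1 a2 a3 a4 a6 _ [-> -> -> -> ->].
rewrite /wintegral /=; set c := qc F; set A4 := qb F * qd F - 4 * qa F * qe F.
set A6 := qa F * qd F ^+ 2 + qb F ^+ 2 * qe F - 4 * qa F * c * qe F.
have int_div m x : vge 0 (x / u ^+ m) -> vge m%:Z x.
  rewrite vgeM_r ?invr_eq0 ?expf_neq0 // vV ?expf_neq0 // vX // opprK add0r => /vgeW; apply.
  by apply: ler_peMl.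
move=> /and5P[i1 /int_div i2 /int_div i3 /int_div i4 /int_div i6].
(* As 2 is a unit, integrality of a1 and a3 gives v(s) >= 1 and v(t) >= 3; the terms s^2, 2 s t and
   t^2 are then absorbed by the bounds 2, 4 and 6. *)
have hs : vge 1 s.
  have /(int_div 1%N) : vge 0 ((0 + 2 * s) / u ^+ 1) by rewrite expr1.
  by rewrite add0r vgeM_l // v2 subr0.
have ht : vge 3 t by move: i3; rewrite mulr0 !add0r vgeM_l // v2 subr0.
have hs0 : vge 0 s by apply: vgeW hs _.
split.
- have -> : c + 3 * r = c - s * 0 + 3 * r - s ^+ 2 + s * s by ring.
  by apply: vgeD i2 _; apply: (vgeM hs hs).
- have -> : A4 + 2 * r * c + 3 * r ^+ 2 = (A4 - s * 0 + 2 * r * c - (t + r * s) * 0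
    + 3 * r ^+ 2 - 2 * s * t) + 2 * (s * t) by ring.
  by apply: vgeD i4 _; apply: vgeZl; [apply: vge_nat | apply: (vgeM hs ht)].
have -> : A6 + r * A4 + r ^+ 2 * c + r ^+ 3 = (A6 + r * A4 + r ^+ 2 * c + r ^+ 3
   - t * 0 - t ^+ 2 - r * t * 0) + t * t by ring.
by apply: vgeD i6 _; apply: (vgeM ht ht).
Qed.

(** This is [cuspidal_triple_root] after reduction modulo pi: [r] is integral since the cubic is
    monic, and perfectness of k supplies cube roots in characteristic 3. *)
Lemma resolvent_triple_root F r : 2%N \notin [pchar k] -> qvge 0 F -> ~~ qvge 1 F ->
  let W := jacW F in
  vge 1 (wa2 W + 3 * r) -> vge 1 (wa4 W + 2 * r * wa2 W + 3 * r ^+ 2) ->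
  vge 1 (wa6 W + r * wa4 W + r ^+ 2 * wa2 W + r ^+ 3) ->
  has_triple_root D F.
Proof.
move=> n2; case: F => a b c d e /and5P[/= ha hb hc hd he] nF h2 h4 h6.
have hr : vge 0 r.
  by apply: (@vge_monic_root _ _ _ _ hc _ _ (vgeW h6 _)) => //; vg.
have z2 : red (c + 3 * r) = 0 by apply/eqP; rewrite red_eq0 //; apply: vgeW h2 _.
have z4 : red (b * d - 4 * a * e + 2 * r * c + 3 * r ^+ 2) = 0.
  by apply/eqP; rewrite red_eq0 //; apply: vgeW h4 _.
have z6 : red (a * d ^+ 2 + b ^+ 2 * e - 4 * a * c * e + r * (b * d - 4 * a * e)
    + r ^+ 2 * c + r ^+ 3) = 0 by apply/eqP; rewrite red_eq0 //; apply: vgeW h6 _.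
have two0 : 2 != 0 :> k by apply: contra n2; rewrite inE.
have cube : 3 = 0 :> k -> forall y : k, exists z, z ^+ 3 = y.
  by move=> e3; apply: (dv_perfect D); rewrite inE /= e3.
move: z2 z4 z6; red_push => z2 z4 z6.
have [x0 [z0 [p [q [xz [ea eb ec ed ee]]]]]] := cuspidal_triple_root two0 cube z2 z4 z6.
exists x0, z0; split=> //.
apply: (@triple_root_intro _ _ D (Quartic a b c d e) _ _ _ _ _ ea eb ec ed ee).
apply: contraR nF; rewrite negb_or !negbK => /andP[/eqP p0 /eqP q0].
rewrite p0 q0 in ea eb ec ed ee.
by apply/and5P; rewrite /= -!red_eq0 // ea eb ec ed ee; split; apply/eqP; ring.
Qed.

(** The cubic reduces to X^3, so pi divides [r]. If [b] is a unit, the constant condition reads b^2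
    e = 0 modulo pi^2. Otherwise [a] is a unit, pi^2 divides b d, and the linear condition gives 4 a
    e = 0 modulo pi^2. *)
Lemma resolvent_qe G r : 2%N \notin [pchar k] -> qwge 0 0 1 1 1 G -> ~~ qvge 1 G ->
  let W := jacW G in
  vge 2 (wa4 W + 2 * r * wa2 W + 3 * r ^+ 2) ->
  vge 2 (wa6 W + r * wa4 W + r ^+ 2 * wa2 W + r ^+ 3) -> vge 2 (qe G).
Proof.
move=> n2; case: G => a b c d e /and5P[/= ha hb hc hd he] nG h4 h6.
have [two0 v2] := two_unit n2.
have [ic id ie] : [/\ vge 0 c, vge 0 d & vge 0 e].
  by split; [apply: vgeW hc _ | apply: vgeW hd _ | apply: vgeW he _].
have hr : vge 0 r.
  by apply: (@vge_monic_root _ _ _ _ ic _ _ (vgeW h6 _)) => //; vg.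
have hr1 : vge 1 r.
  have : vge 1 (r ^+ 3).
    have -> : r ^+ 3 = a * d ^+ 2 + b ^+ 2 * e - 4 * a * c * e + r * (b * d - 4 * a * e)
     + r ^+ 2 * c + r ^+ 3 - (a * d ^+ 2 + b ^+ 2 * e - 4 * a * c * e + r * (b * d - 4 * a * e)
     + r ^+ 2 * c) by ring.
    by apply: vgeD; [apply: vgeW h6 _ | vg].
  rewrite /vge expf_eq0 /=; case: eqVneq => //= r0; rewrite vX //.
  by clear; vlia.
have m2 x y : vge 1 x -> vge 1 y -> vge 2 (x * y) by move=> hx hy; apply: (vgeM hx hy).
have a4 : vge 2 (b * d - 4 * a * e).
  have -> : b * d - 4 * a * e = b * d - 4 * a * e + 2 * r * c + 3 * r ^+ 2
    - (2 * (r * c) + 3 * (r * r)) by ring.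
  by apply: vgeD h4 _; rewrite vgeN; apply: vgeD; apply: vgeZl; rewrite ?vge_nat ?m2.
have [hb1|nb] := boolP (vge 1 b); last first.
  have [b0 vb] := vgePn hb nb.
  have : vge 2 (b ^+ 2 * e).
    have -> : b ^+ 2 * e = a * d ^+ 2 + b ^+ 2 * e - 4 * a * c * e + r * (b * d - 4 * a * e)
     + r ^+ 2 * c + r ^+ 3 - (a * (d * d) + 4 * a * - (c * e) + r * (b * d - 4 * a * e)
     + (r * r) * (c + r)) by ring.
    apply: vgeD h6 _; rewrite vgeN.
    have := m2 _ _ hd hd; have := m2 _ _ hc he; have := m2 _ _ hr1 hr1 => k1 k2 k3.
    by apply: vgeD; last (apply: vgeZr => //; vg); vg.
  by rewrite vgeM_l ?expf_neq0 // vX // vb mul0r subr0.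
have na : ~~ vge 1 a by apply: contra nG => h; apply/and5P; split.
have [a0 va] := vgePn ha na.
have : vge 2 (2 ^+ 2 * a * e).
  have -> : 2 ^+ 2 * a * e = b * d - (b * d - 4 * a * e) by ring.
  by apply: vgeD; rewrite ?vgeN ?m2.
rewrite vgeM_l ?mulf_neq0 ?expf_neq0 // dv_vM ?expf_neq0 // ?vX // v2 va.
by move=> h; apply: vgeW h _.
Qed.

End Level.

(** * The triple root, integrality and independence of choices *)

Section Procedure.
Variables (K k : fieldType) (D : dvf K k).
Local Notation v := (dv_v D).
Local Notation pi := (dv_pi D).
Local Notation vge := (vge D).
Local Notation qwge := (qwge D).
Local Notation qvge := (qvge D).
Local Notation descend := (descend D).
Implicit Types (F G H : quartic K) (M N U : 'M[K]_2).

Lemma vform_exact F : nonsingular F ->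
  qvge (vform D F) F /\ ~~ qvge (vform D F + 1) F.
Proof.
move=> /nonsingular_neq0 F0; rewrite -!le_vform // lexx; split=> //.
by rewrite -ltNge ltzD1.
Qed.

(** Through this, properties of the procedure for an arbitrary [M] need only be checked for one
    convenient [U]. *)
Lemma descend_unique n F U M : GL2O D U -> GL2O D M -> ~~ qvge (n + 1) F ->
  qwge n n (n + 1) (n + 1) (n + 1) (qsubst F U) ->
  qwge n n (n + 1) (n + 1) (n + 1) (qsubst F M) ->
  exists2 N, GL2O D N & descend (qsubst F M) = qsubst (descend (qsubst F U)) N.
Proof.
move=> hU hM nF wU; have [U' hU' [U'U UU']] := GL2O_inv hU.
have hN : GL2O D (M *m U') by apply: GL2O_mul.
have -> : qsubst F M = qsubst (qsubst F U) (M *m U').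
  by rewrite qsubst_mul -mulmxA U'U mulmx1.
move=> wM; apply: descend_subst => //.
by apply: triple_root_unique wU wM _ => //; rewrite qvge_GL2O.
Qed.

Lemma qwgeW (m4 m3 m2 m1 m0 n4 n3 n2 n1 n0 : int) F : qwge n4 n3 n2 n1 n0 F ->
  m4 <= n4 -> m3 <= n3 -> m2 <= n2 -> m1 <= n1 -> m0 <= n0 -> qwge m4 m3 m2 m1 m0 F.
Proof.
by move=> /and5P[h4 h3 h2 h1 h0] *; apply/and5P; split;
  [apply: vgeW h4 _|apply: vgeW h3 _|apply: vgeW h2 _|apply: vgeW h1 _|apply: vgeW h0 _].
Qed.

(** Both weight patterns bound the last three valuations below by 2 >= n + 1, so [U] already puts
    the triple root at (0 : 1). *)
Lemma nonminimal_root_form F (n := vform D F) : qvge 0 F -> nonsingular F -> n = 0 \/ n = 1 ->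
  nonminimal D F -> exists2 U, GL2O D U &
    qwge n n (n + 1) (n + 1) (n + 1) (qsubst F U) /\
    (qwge 0 1 2 3 4 (qsubst F U) \/ qwge 0 0 2 4 6 (qsubst F U)).
Proof.
move=> iF nsF n01 nm; have [Fn nFn] := vform_exact nsF.
have n2 : ~~ qvge 2 F.
  apply: contra nFn => h; apply: (qvgeW h); case: n01 => nE; by rewrite -/n nE.
have [U hU w] := nonminimal_weights nsF iF nm n2.
exists U => //; split=> //.
have : qvge n (qsubst F U) by rewrite qvge_GL2O.
move=> /and5P[ha hb _ _ _].
have : qwge 0 0 2 2 2 (qsubst F U) by case: w => w; apply: (qwgeW w).
move=> /and5P[_ _ hc hd he]; apply/and5P; split=> //;
  [apply: (vgeW hc)|apply: (vgeW hd)|apply: (vgeW he)]; by case: n01 => ->.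
Qed.

Lemma positive_level_triple_root F (n := vform D F) : qvge 0 F -> nonsingular F ->
  n = 0 \/ n = 1 -> (exists l : int, 0 < l /\ is_level D F l) ->
  (2%N \in [pchar k] -> nonminimal D F) ->
  has_triple_root D (qscale (pi ^ (- n)) F).
Proof.
move=> iF nsF n01 [l [l0 lF]] nm2; have [Fn nFn] := vform_exact nsF.
have iF1 : qvge 0 (qscale (pi ^ (- n)) F) by rewrite qvge_scale_pi add0r.
have nF1 : ~~ qvge 1 (qscale (pi ^ (- n)) F) by rewrite qvge_scale_pi addrC.
have [c2|n2] := boolP (2%N \in [pchar k]).
  have [U hU [wU _]] := nonminimal_root_form iF nsF n01 (nm2 c2).
  have [V hV [VU _]] := GL2O_inv hU.
  set F1 := qscale _ _ in iF1 nF1 *.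
  have -> : F1 = qsubst (qsubst F1 U) V by rewrite qsubst_mul VU qsubst1.
  apply: (triple_root_subst hV); last by rewrite qvge_GL2O.
  have p0 : pi ^ (- n) != 0 by rewrite expfz_neq0 ?dv_pi_neq0.
  move: wU; rewrite /F1 qsubst_scale /qwge /qscale /= !vgeM_l // vpiz opprK !add0r.
  by rewrite -/n (addrC 1).
have [r [h2 h4 h6]] := pos_level_resolvent n2 nsF lF l0.
have p0 := dv_pi_neq0 D.
(* Scaling by pi^-n scales the roots of the resolvent likewise; the bounds 2, 4, 6 lose n, 2n, 3n
   and stay at least 1. *)
apply: (@resolvent_triple_root _ _ _ _ (pi ^ (- n) * r)) => //; move: h2 h4 h6;
  rewrite /jacW /qscale /=; set m := pi ^ (- n); set c := qc F;
  set A4 := qb F * qd F - _; set A6 := qa F * qd F ^+ 2 + _ - _ => h2 h4 h6.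
- have -> : m * c + 3 * (m * r) = m * (c + 3 * r) by ring.
  rewrite vgeM_l ?expfz_neq0 // vpiz opprK; apply: (vgeW h2).
  by case: n01 => ->.
- have -> : m * qb F * (m * qd F) - 4 * (m * qa F) * (m * qe F)
    + 2 * (m * r) * (m * c) + 3 * (m * r) ^+ 2
    = m * (m * (A4 + 2 * r * c + 3 * r ^+ 2)) by rewrite /A4; ring.
  rewrite !vgeM_l ?expfz_neq0 // vpiz !opprK; apply: (vgeW h4).
  by case: n01 => ->.
have -> : m * qa F * (m * qd F) ^+ 2 + (m * qb F) ^+ 2 * (m * qe F)
   - 4 * (m * qa F) * (m * c) * (m * qe F)
   + m * r * (m * qb F * (m * qd F) - 4 * (m * qa F) * (m * qe F))
   + (m * r) ^+ 2 * (m * c) + (m * r) ^+ 3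
    = m * (m * (m * (A6 + r * A4 + r ^+ 2 * c + r ^+ 3))) by rewrite /A4 /A6; ring.
rewrite !vgeM_l ?expfz_neq0 // vpiz !opprK; apply: (vgeW h6).
by case: n01 => ->.
Qed.

(** Only v(d) >= 1 and v(e) >= 2 are at stake. In residue characteristic 2 they are read off the
    non-minimal shape; otherwise n = 1 is immediate and n = 0 is [resolvent_qe]. *)
Lemma qvge_descend F (n := vform D F) M : qvge 0 F -> nonsingular F ->
  n = 0 \/ n = 1 -> (exists l : int, 0 < l /\ is_level D F l) ->
  (2%N \in [pchar k] -> nonminimal D F) -> GL2O D M ->
  qwge n n (n + 1) (n + 1) (n + 1) (qsubst F M) ->
  qvge 0 (descend (qsubst F M)).
Proof.
move=> iF nsF n01 [l [l0 lF]] nm2 hM wM; have [Fn nFn] := vform_exact nsF.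
have [c2|n2] := boolP (2%N \in [pchar k]).
  have [U hU [wU w]] := nonminimal_root_form iF nsF n01 (nm2 c2).
  have [N hN ->] := descend_unique hU hM nFn wU wM.
  by rewrite qvge_GL2O // /qvge qwge_descend; case: w => w; apply: (qwgeW w).
rewrite /qvge qwge_descend; move: (wM); case: n01 => nE; rewrite nE;
  last by move=> w; apply: (qwgeW w).
move=> w; have [r [_ h4 h6]] :=
  pos_level_resolvent n2 (nonsingular_GL2O hM nsF) ((is_level_GL2O l hM nsF).1 lF) l0.
have he : vge 2 (qe (qsubst F M)).
  apply: (resolvent_qe n2 w _ (vgeW h4 _) (vgeW h6 _)) => //.
  by rewrite qvge_GL2O // -[X in qvge X](add0r 1) -nE.
move: w => /and5P[ha hb hc hd _]; apply/and5P; split=> //;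
  [apply: (vgeW ha)|apply: (vgeW hb)|apply: (vgeW hc)]; done.
Qed.

End Procedure.

Theorem theorem4p2 (K k : fieldType) (D : dvf K k) (F : quartic K) :
  qintegral D F -> nonsingular F ->
  (vform D F = 0 \/ vform D F = 1) ->
  (exists l : int, 0 < l /\ is_level D F l) ->
  (2%N \in [pchar k] -> nonminimal D F) ->
  (* (i) *)
  has_triple_root D (qscale (dv_pi D ^ (- vform D F)) F) /\
  (* (ii) *)
  (forall M G F', step D F M G F' ->
     [/\ qintegral D F', Kequiv F F' & forall l, is_level D F l <-> is_level D F' l]) /\
  (* (iii) *)
  (nonminimal D F ->
     forall M G F', step D F M G F' ->
       2 <= vform D F' \/
       forall M' G' F'', step D F' M' G' F'' -> 2 <= vform D F'').
Proof.
rewrite qvge0E => iF nsF n01 lF nm2; have [Fn nFn] := vform_exact D nsF.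
split; first exact: positive_level_triple_root.
split=> [M G F' /stepE/(_ Fn)[hM -> -> wM]|nm M G F' /stepE/(_ Fn)[hM -> -> wM]].
  have nsG := nonsingular_GL2O hM nsF.
  split; first by rewrite qvge0E qvge_descend.
    by apply: Kequiv_descend; case/GL2OE: hM => _ [].
  by move=> l; rewrite (is_level_GL2O l hM nsF); apply: is_level_descend.
have [U hU [wU w]] := nonminimal_root_form iF nsF n01 nm.
have [N hN EN] := descend_unique hU hM nFn wU wM.
set H := descend D (qsubst F U) in EN; set F1 := descend D (qsubst F M) in EN *.
have nsF1 : nonsingular F1 by exact: (nonsingular_descend D (nonsingular_GL2O hM nsF)).
have nzF1 := nonsingular_neq0 nsF1.
have [h2|h2] := boolP (2 <= vform D F1); [by left | right].
(* The weights (0,1,2,3,4) become (2,2,2,2,2) at once, contradicting [h2]. *)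
case: w => w.
  by case/negP: h2; rewrite le_vform // EN qvge_GL2O // /qvge qwge_descend; apply: (qwgeW w).
have wH : qwge D 2 1 2 3 4 H by rewrite qwge_descend; apply: (qwgeW w).
have F11 : vform D F1 = 1.
  have : 1 <= vform D F1 by rewrite le_vform // EN qvge_GL2O //; apply: (qwgeW wH).
  by move: h2; clear; set x := vform _ _; clearbody x; lia.
have [F1n nF1n] := vform_exact D nsF1.
move=> M' G' F'' /stepE/(_ F1n)[hM' -> ->]; rewrite F11 in nF1n * => wM'.
have nsF'' := nonsingular_descend D (nonsingular_GL2O hM' nsF1).
rewrite le_vform; last exact: nonsingular_neq0.
(* [N'] brings [F1] back to [H], whose weights (2,1,2,3,4) already have the triple root at (0 : 1)
   for n = 1; descending there gives (4,2,2,2,2). *)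
have [N' hN' [NN' N'N]] := GL2O_inv hN.
have EH : qsubst F1 N' = H by rewrite EN qsubst_mul NN' qsubst1.
have wH' : qwge D 1 1 2 2 2 (qsubst F1 N') by rewrite EH; apply: (qwgeW wH).
have [N2 hN2 ->] := descend_unique hN' hM' nF1n wH' wM'.
by rewrite qvge_GL2O // EH /qvge qwge_descend; apply: (qwgeW wH).
Qed.
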